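(* Let $\mathcal C$ be a fusion category (over $\mathbb C$) with a commutative Grothendieck ring $K(\mathcal C)$. Then $K(\mathcal C)$ is dual-Burnside if and only if the following holds (in $K(\mathcal C)\otimes_{\mathbb Z}\mathbb C$): $$\Big(\prod_{i=1}^m\frac{x_i}{d_i}\Big)^2=\frac{1}{\mathrm{FPdim}(\mathcal C_{ad})}\Big(\sum_{x_i\in\mathcal C_{ad}}d_i\,x_i\Big).$$
   Context: $X_1,\dots,X_m$ are representatives of the isomorphism classes of simple objects of $\mathcal C$ ($X_1$ the unit), $x_i=[X_i]\in K(\mathcal C)$, $d_i=\mathrm{FPdim}(X_i)$ the Frobenius–Perron dimension. $\mathcal C_{ad}$ is the adjoint fusion subcategory, generated by all $X_i\otimes X_i^*$; $x_i\in\mathcal C_{ad}$ means $X_i\in\mathcal C_{ad}$; $\mathrm{FPdim}(\mathcal C_{ad})=\sum_{X_i\in\mathcal C_{ad}}d_i^2$. Let $H=K(\mathcal C)\otimes\mathbb C$ and let $\widehat{\mathcal B}=\{\mu_1=\mathrm{FPdim},\mu_2,\dots,\mu_m\}$ be the set of unital algebra morphisms $H\to\mathbb C$, a basis of $H^*$. The dual hypergroup of $K(\mathcal C)$ is $H^*$ with basis $\widehat{\mathcal B}$, product $(f\star g)(x_i/d_i)=f(x_i/d_i)g(x_i/d_i)$ for all $i$, unit $\mu_1$, involution $\mu_{j^\#}(x_i)=\mu_j(x_{i^*})$ where $x_{i^*}=[X_i^*]$. Write $\mu_i\star\mu_j=\sum_k\widehat p_k(i,j)\mu_k$; $\mu_j$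 is grouplike in the dual if $\mu_j\star\mu_{j^\#}=\widehat p_1(j,j^\#)\mu_1$. $K(\mathcal C)$ is dual-Burnside if for every $\mu_j\in\widehat{\mathcal B}$: there is $i$ with $\mu_j(x_i)=0$ if and only if $\mu_j$ is not grouplike in the dual. *)

(* Defs.v *)
From HB Require Import structures.
From mathcomp Require Import all_boot all_order all_algebra.
From mathcomp Require Import boolp classical_sets reals.
From mathcomp Require Import complex.

Set Implicit Arguments.
Unset Strict Implicit.
Unset Printing Implicit Defensive.

Import GRing.Theory.

Local Open Scope classical_set_scope.
Local Open Scope ring_scope.

(* Hom-spaces are [vectType]s, so finite-dimensionality of the Hom-spaces is
   part of the structure. [comp g f] is "g after f". *)
Record linear_category (k : fieldType) := LinearCategory {
  obj :> Type;
  hom : obj -> obj -> vectType k;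
  idm : forall X : obj, hom X X;
  comp : forall X Y Z : obj, hom Y Z -> hom X Y -> hom X Z;
  comp_linearl : forall (X Y Z : obj) (f : hom X Y),
    linear (fun g : hom Y Z => comp g f);
  comp_linearr : forall (X Y Z : obj) (g : hom Y Z),
    linear (fun f : hom X Y => comp g f);
  comp_idl : forall (X Y : obj) (f : hom X Y), comp (idm Y) f = f;
  comp_idr : forall (X Y : obj) (f : hom X Y), comp f (idm X) = f;
  comp_assoc : forall (W X Y Z : obj) (h : hom Y Z) (g : hom X Y) (f : hom W X),
    comp h (comp g f) = comp (comp h g) f
}.

Arguments hom {k l} X Y.
Arguments idm {k l} X.
Arguments comp {k l X Y Z} g f.

Notation "g \oc f" := (comp g f) (at level 40, left associativity).

Section Abelian.
Context {k : fieldType} {C : linear_category k}.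
Implicit Types X Y Z : C.

Definition is_mono X Y (f : hom X Y) : Prop :=
  forall W (g h : hom W X), f \oc g = f \oc h -> g = h.

Definition is_epi X Y (f : hom X Y) : Prop :=
  forall Z (g h : hom Y Z), g \oc f = h \oc f -> g = h.

Definition is_inverse X Y (f : hom X Y) (g : hom Y X) : Prop :=
  g \oc f = idm X /\ f \oc g = idm Y.

Definition is_iso X Y (f : hom X Y) : Prop := exists g : hom Y X, is_inverse f g.

Definition isomorphic X Y : Prop := exists f : hom X Y, is_iso f.

(* Initial and terminal: the only morphisms from or to [X] are the zero ones. *)
Definition is_zero_obj X : Prop :=
  (forall Y (f : hom X Y), f = 0) /\ (forall Y (f : hom Y X), f = 0).

(* [Y] is a direct sum (biproduct) of the finite family [Z]; for [r = 0] this
   says that [Y] is a zero object. *)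
Definition is_direct_sum r (Z : 'I_r -> C) Y : Prop :=
  exists (inj : forall a, hom (Z a) Y) (prj : forall a, hom Y (Z a)),
    [/\ forall a, prj a \oc inj a = idm (Z a),
        forall a b, a != b -> prj a \oc inj b = 0
      & \sum_a inj a \oc prj a = idm Y].

Definition is_kernel X Y (f : hom X Y) K (i : hom K X) : Prop :=
  f \oc i = 0 /\
  forall W (g : hom W X), f \oc g = 0 -> exists! u : hom W K, i \oc u = g.

Definition is_cokernel X Y (f : hom X Y) Q (p : hom Y Q) : Prop :=
  p \oc f = 0 /\
  forall W (g : hom Y W), g \oc f = 0 -> exists! u : hom Q W, u \oc p = g.

Definition is_simple X : Prop :=
  ~ is_zero_obj X /\
  forall Y (i : hom Y X), is_mono i -> is_zero_obj Y \/ is_iso i.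

End Abelian.

Definition is_abelian (k : fieldType) (C : linear_category k) : Prop :=
  [/\ forall r (Z : 'I_r -> C), exists Y, is_direct_sum Z Y,
      forall (X Y : C) (f : hom X Y), exists K (i : hom K X), is_kernel f i,
      forall (X Y : C) (f : hom X Y), exists Q (p : hom Y Q), is_cokernel f p,
      forall (X Y : C) (i : hom X Y),
        is_mono i -> exists Z (f : hom Y Z), is_kernel f i
    & forall (X Y : C) (p : hom X Y),
        is_epi p -> exists Z (f : hom Z X), is_cokernel f p].

Definition is_semisimple (k : fieldType) (C : linear_category k) : Prop :=
  forall Y : C, exists r (Z : 'I_r -> C),
    (forall a, is_simple (Z a)) /\ is_direct_sum Z Y.

Definition finitely_many_simples (k : fieldType) (C : linear_category k) : Prop :=
  exists r (Z : 'I_r -> C),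
    (forall a, is_simple (Z a)) /\
    forall Y : C, is_simple Y -> exists a, isomorphic Y (Z a).

Record monoidal_category (k : fieldType) := MonoidalCategory {
  lincat :> linear_category k;
  tens : lincat -> lincat -> lincat;
  tensm : forall X X' Y Y' : lincat,
    hom X X' -> hom Y Y' -> hom (tens X Y) (tens X' Y');
  tunit : lincat;
  tens_linearl : forall (X X' Y Y' : lincat) (g : hom Y Y'),
    linear (fun f : hom X X' => tensm f g);
  tens_linearr : forall (X X' Y Y' : lincat) (f : hom X X'),
    linear (fun g : hom Y Y' => tensm f g);
  tensm_id : forall X Y : lincat, tensm (idm X) (idm Y) = idm (tens X Y);
  tensm_comp : forall (X X' X'' Y Y' Y'' : lincat) (f' : hom X' X'')
      (f : hom X X') (g' : hom Y' Y'') (g : hom Y Y'),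
    tensm (f' \oc f) (g' \oc g) = tensm f' g' \oc tensm f g;
  (* associator and unitors, with their inverses *)
  assoc : forall X Y Z : lincat, hom (tens (tens X Y) Z) (tens X (tens Y Z));
  assocV : forall X Y Z : lincat, hom (tens X (tens Y Z)) (tens (tens X Y) Z);
  lunit : forall X : lincat, hom (tens tunit X) X;
  lunitV : forall X : lincat, hom X (tens tunit X);
  runit : forall X : lincat, hom (tens X tunit) X;
  runitV : forall X : lincat, hom X (tens X tunit);
  assocK : forall X Y Z : lincat, is_inverse (assoc X Y Z) (assocV X Y Z);
  lunitK : forall X : lincat, is_inverse (lunit X) (lunitV X);
  runitK : forall X : lincat, is_inverse (runit X) (runitV X);
  assoc_natural : forall (X X' Y Y' Z Z' : lincat)
      (f : hom X X') (g : hom Y Y') (h : hom Z Z'),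
    assoc X' Y' Z' \oc tensm (tensm f g) h
      = tensm f (tensm g h) \oc assoc X Y Z;
  lunit_natural : forall (X X' : lincat) (f : hom X X'),
    lunit X' \oc tensm (idm tunit) f = f \oc lunit X;
  runit_natural : forall (X X' : lincat) (f : hom X X'),
    runit X' \oc tensm f (idm tunit) = f \oc runit X;
  pentagon : forall W X Y Z : lincat,
    assoc W X (tens Y Z) \oc assoc (tens W X) Y Z
      = tensm (idm W) (assoc X Y Z) \oc assoc W (tens X Y) Z
          \oc tensm (assoc W X Y) (idm Z);
  triangle : forall X Y : lincat,
    tensm (idm X) (lunit Y) \oc assoc X tunit Y = tensm (runit X) (idm Y)
}.

Arguments tens {k m} X Y.
Arguments tensm {k m X X' Y Y'} f g.
Arguments tunit {k m}.
Arguments assoc {k m} X Y Z.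
Arguments assocV {k m} X Y Z.
Arguments lunit {k m} X.
Arguments lunitV {k m} X.
Arguments runit {k m} X.
Arguments runitV {k m} X.

Notation "X \ox Y" := (tens X Y) (at level 40, left associativity).

(* The two triangle identities: [Xd] is a left dual of [X], equivalently [X] is a right dual of [Xd]. *)
Definition is_left_dual (k : fieldType) (C : monoidal_category k) (X Xd : C) :
    Prop :=
  exists (ev : hom (Xd \ox X) tunit) (coev : hom tunit (X \ox Xd)),
    runit X \oc tensm (idm X) ev \oc assoc X Xd X
      \oc tensm coev (idm X) \oc lunitV X = idm X /\
    lunit Xd \oc tensm ev (idm Xd) \oc assocV Xd X Xd
      \oc tensm (idm Xd) coev \oc runitV Xd = idm Xd.

(* [dual X] is a chosen left dual X^*; any other choice is isomorphic to it. *)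
Record fusion_category (k : fieldType) := FusionCategory {
  moncat :> monoidal_category k;
  fusion_abelian : is_abelian moncat;
  fusion_semisimple : is_semisimple moncat;
  fusion_finite : finitely_many_simples moncat;
  fusion_unit_simple : is_simple (tunit : moncat);
  dual : moncat -> moncat;
  dualP : forall X : moncat, is_left_dual X (dual X);
  fusion_right_dual : forall X : moncat, exists Y : moncat, is_left_dual Y X
}.

Arguments dual {k f} X.

(* Membership is a property of objects, since subcategories are full; closure
   under subobjects makes it invariant under isomorphism. *)
Definition is_fusion_subcategory (k : fieldType) (C : fusion_category k)
    (D : set C) : Prop :=
  [/\ D tunit,
      forall X Y, D X -> D Y -> D (X \ox Y),
      forall X, D X -> D (dual X),
      forall r (Z : 'I_r -> C) Y, (forall a, D (Z a)) -> is_direct_sum Z Y -> D Y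
    & (forall X Y (i : hom Y X), is_mono i -> D X -> D Y) /\
      (forall X Y (p : hom X Y), is_epi p -> D X -> D Y)].

Section Simples.
Context {k : fieldType} {C : fusion_category k} {n : nat}.

(* The rank of the category is [n.+1] and the unit object has index [ord0]. *)
Definition simple_representatives (X : 'I_n.+1 -> C) : Prop :=
  [/\ X ord0 = tunit,
      forall i, is_simple (X i),
      forall i j, isomorphic (X i) (X j) -> i = j
    & forall Y : C, is_simple Y -> exists i, isomorphic Y (X i)].

Variable X : 'I_n.+1 -> C.

Definition adjoint_subcategory : set C :=
  [set Y | forall D : set C, is_fusion_subcategory D ->
     (forall i, D (X i \ox dual (X i))) -> D Y].

(* [C] being semisimple and k being algebraically closed in the sequel, this is
   the multiplicity of [X i] in [Y], i.e. the coefficient of x_i in [Y]. *)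
Definition mult (Y : C) (i : 'I_n.+1) : nat := \dim {: hom (X i) Y}.

(* The Grothendieck ring with scalars extended to [A], i.e. K(C) (x) A: the free
   [A]-module on the classes x_i = [X i] of the simple objects. The ring K(C)
   itself is the case [A = int]. *)
Section Grothendieck.
Variable A : comNzRingType.

Definition gsimple (i : 'I_n.+1) : 'rV[A]_n.+1 := delta_mx 0 i.

Definition gclass (Y : C) : 'rV[A]_n.+1 := \row_i (mult Y i)%:R.

Definition gone : 'rV[A]_n.+1 := gclass tunit.

Definition gmul (a b : 'rV[A]_n.+1) : 'rV[A]_n.+1 :=
  \sum_i \sum_j (a 0 i * b 0 j) *: gclass (X i \ox X j).

End Grothendieck.

Definition groth_commutative : Prop :=
  forall a b : 'rV[int]_n.+1, gmul a b = gmul b a.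

End Simples.

Arguments gsimple {n A} i.
Arguments gmul {k C n} X {A} a b.

Section DualHypergroup.
Local Open Scope complex_scope.
Context {R : realType} {C : fusion_category R[i]} {n : nat}.
Variable X : 'I_n.+1 -> C.

(* Row [j] is [Y] * x_j. As vectors are rows, v |-> v *m leftmult_mx Y is left
   multiplication by [Y] on K(C) (x) R. *)
Definition leftmult_mx (Y : C) : 'M[R]_n.+1 :=
  \matrix_(j, l) (mult X (Y \ox X j) l)%:R.

(* The largest nonnegative eigenvalue: the set is finite, and nonempty by the
   Perron-Frobenius theorem, so that its supremum is its maximum. *)
Definition FPdim (Y : C) : R :=
  sup [set a : R | 0 <= a /\ eigenvalue (leftmult_mx Y) a].

Definition FPdim_ad : R :=
  \sum_(i | `[< adjoint_subcategory X (X i) >]) FPdim (X i) ^+ 2.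

Local Notation K_C := 'rV[R[i]]_n.+1.
Local Notation K_C_dual := 'Hom('rV[R[i]]_n.+1, R[i]^o).

Definition dim_simple (i : 'I_n.+1) : R[i] := (FPdim (X i))%:C.

(* The linear functional with value [v i] at x_i. *)
Definition linext (v : 'I_n.+1 -> R[i]) : K_C_dual :=
  linfun (fun a : K_C => \sum_i a 0 i * v i : R[i]^o).

Lemma linextE (v : 'I_n.+1 -> R[i]) (i : 'I_n.+1) : linext v (gsimple i) = v i.
Proof.
pose f (a : K_C) : R[i]^o := \sum_i a 0 i * v i.
have f_lin : linear f.
  move=> c a b; rewrite /f scaler_sumr -big_split /=; apply: eq_bigr => j _.
  by rewrite !mxE mulrDl -mulrA.
pose lm := GRing.isLinear.Build R[i] K_C R[i]^o *:%R f f_lin.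
pose fl : {linear K_C -> R[i]^o} := HB.pack f lm.
rewrite [linext v](_ : _ = linfun fl) // lfunE /= /f (bigD1 i) //= big1 => [|j ji].
  by rewrite !mxE !eqxx mul1r addr0.
by rewrite !mxE (negPf ji) andbF mul0r.
Qed.

Definition is_algebra_morphism (f : K_C_dual) : Prop :=
  f (gone X _) = 1 /\ forall a b : K_C, f (gmul X a b) = f a * f b.

(* [mu] lists the set of unital algebra morphisms, without repetition and with
   FPdim in first position. *)
Definition is_character_list (mu : n.+1.-tuple K_C_dual) : Prop :=
  [/\ tnth mu ord0 = linext dim_simple,
      uniq mu
    & forall f : K_C_dual, f \in mu <-> is_algebra_morphism f].

(* The functional with (f * g)(x_i / d_i) = f(x_i / d_i) g(x_i / d_i). *)
Definition star (f g : K_C_dual) : K_C_dual :=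
  linext (fun i => let y : K_C := (dim_simple i)^-1 *: gsimple i in
    dim_simple i * (f y * g y)).

Definition sharp (f : K_C_dual) : K_C_dual :=
  linext (fun i => f (gclass X _ (dual (X i)))).

Section Characters.
Variable mu : n.+1.-tuple K_C_dual.

(* The coefficient of mu_l in f * g, with respect to the basis mu. *)
Definition phat (l : 'I_n.+1) (f g : K_C_dual) : R[i] := coord mu l (star f g).

Definition is_dual_grouplike (f : K_C_dual) : Prop :=
  star f (sharp f) = phat ord0 f (sharp f) *: tnth mu ord0.

Definition dual_Burnside : Prop :=
  forall j : 'I_n.+1,
    (exists i : 'I_n.+1, tnth mu j (gsimple i) = 0) <->
    ~ is_dual_grouplike (tnth mu j).

End Characters.

End DualHypergroup.

(* Main.v *)
(* The m characters mu_j separate K(C) (x) C, so the identity may be tested on each of them: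
   with u_i = mu_j(x_i), it says that (\prod_i u_i / d_i)^2 equals
   (\sum_(ad) d_i u_i) / FPdim(C_ad).
   Since |u_i| <= d_i, the equality u_i u_(i^* ) = d_i^2 forces u_l = d_l on all the
   constituents of X_i (x) X_i^*, and mu_j is grouplike in the dual iff u = d on C_ad. In that
   case both sides are 1: pair i with i^* in the product. Otherwise the right-hand side
   vanishes, because the regular element r of C_ad satisfies x_k r = d_k r for X_k in C_ad; so
   the identity for this mu_j says that some u_i is zero. The categorical input is Schur's
   lemma, the adjunction Hom(X^* (x) A, B) = Hom(A, X (x) B), the simplicity of the dual of a
   simple object, and FPdim(X^* ) = FPdim(X), the matrices of X and X^* being transposed. *)
From HB Require Import structures.
From mathcomp Require Import all_boot all_order all_algebra.
From mathcomp Require Import boolp classical_sets reals.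
From mathcomp Require Import complex ring.
Require Import Defs.

Import Order.TTheory GRing.Theory Num.Theory.

Set Implicit Arguments.
Unset Strict Implicit.
Unset Printing Implicit Defensive.

Local Open Scope ring_scope.
Local Open Scope complex_scope.

(** * Linear and semisimple categories *)

Section LinearPredicate.
Context {k : fieldType} {U V : vectType k} {f : U -> V}.
Hypothesis f_lin : linear f.

Let fl : {linear U -> V} :=
  HB.pack f (GRing.isLinear.Build k U V *:%R f f_lin).

Lemma lin0 : f 0 = 0.
Proof. exact: (raddf0 fl). Qed.

Lemma linB u v : f (u - v) = f u - f v.
Proof. exact: (raddfB fl). Qed.

Lemma linZ a u : f (a *: u) = a *: f u.
Proof. exact: (linearZ_LR fl). Qed.

Lemma lin_sum r (F : 'I_r -> U) : f (\sum_i F i) = \sum_i f (F i).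
Proof. exact: (raddf_sum fl). Qed.

Lemma lin_linfunE u : linfun f u = f u.
Proof. exact: (lfunE fl). Qed.

Lemma dim_le_of_inj : injective f -> (\dim {:U} <= \dim {:V})%N.
Proof.
move=> f_inj; rewrite -(@limg_dim_eq _ _ _ (linfun f) fullv) ?dimvS ?subvf //.
apply/eqP; rewrite capfv -subv0; apply/subvP => u.
rewrite memv_ker lin_linfunE memv0 => /eqP fu0.
by apply/eqP/f_inj; rewrite fu0 lin0.
Qed.

End LinearPredicate.

Lemma dim_neq0P {k : fieldType} {U : vectType k} :
  (\dim {:U} != 0)%N <-> exists u : U, u <> 0.
Proof.
rewrite dimv_eq0; split=> [U0|[u u0]].
  by exists (vpick {:U}); apply/eqP; rewrite vpick0.
apply/eqP => U0; apply: u0; apply/eqP; rewrite -memv0 -U0; exact: memvf.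
Qed.

(** Nondegeneracy on the left embeds [U] into ['Hom(V, W)], whose dimension is [dim V * dim W], at
    most [dim V]. *)
Lemma dim_le_of_pairing {k : fieldType} {U V W : vectType k} {b : U -> V -> W} :
    (forall v, linear (b^~ v)) -> (forall u, linear (b u)) ->
    (\dim {:W} <= 1)%N ->
    (forall u, (forall v, b u v = 0) -> u = 0) ->
  (\dim {:U} <= \dim {:V})%N.
Proof.
move=> bl br W1 b_nd; pose B u : 'Hom(V, W) := linfun (b u).
have B_lin : linear B.
  move=> a u v; apply/lfunP => w.
  rewrite [RHS]lfunE /= scale_lfunE !(lin_linfunE (br _)); exact: bl.
apply: (@leq_trans (\dim {: 'Hom(V, W)})).
  apply: (dim_le_of_inj B_lin) => u v Buv.
  apply/eqP; rewrite -subr_eq0; apply/eqP; apply: b_nd => w.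
  have := congr1 (fun h : 'Hom(V, W) => h w) Buv.
  rewrite /B /= !(lin_linfunE (br _)) (linB (bl w)) => ->; exact: subrr.
move: W1; rewrite !dimvf => W1.
by rewrite [dim 'Hom(V, W)]/(dim V * dim W)%N -[leqRHS]muln1 leq_mul2l W1 orbT.
Qed.

Section LinearCategory.
Context {k : fieldType} {C : linear_category k}.
Implicit Types X Y Z W : C.

Lemma comp0l X Y Z (f : hom X Y) : (0 : hom Y Z) \oc f = 0.
Proof. exact: lin0 (comp_linearl f). Qed.

Lemma comp0r X Y Z (g : hom Y Z) : g \oc (0 : hom X Y) = 0.
Proof. exact: lin0 (comp_linearr g). Qed.

Lemma isomorphic_sym X Y : isomorphic X Y -> isomorphic Y X.
Proof. by case=> f [g [gf fg]]; exists g, f. Qed.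

Lemma isomorphic_trans Y X Z :
  isomorphic X Y -> isomorphic Y Z -> isomorphic X Z.
Proof.
case=> f [f' [f'f ff']] [g [g' [g'g gg']]].
exists (g \oc f), (f' \oc g'); split.
  by rewrite comp_assoc -(comp_assoc f') g'g comp_idr.
by rewrite comp_assoc -(comp_assoc g) ff' comp_idr.
Qed.

Lemma mono_of_retraction X Y (f : hom X Y) g : g \oc f = idm X -> is_mono f.
Proof.
move=> gf W u v /(congr1 (comp g)).
by rewrite !comp_assoc gf !comp_idl.
Qed.

Lemma epi_of_section X Y (f : hom X Y) g : f \oc g = idm Y -> is_epi f.
Proof.
move=> fg W u v /(congr1 (fun h => h \oc g)).
by rewrite -!comp_assoc fg !comp_idr.
Qed.

Lemma mono_neq0 X Y Z (i : hom Y Z) (f : hom X Y) :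
  is_mono i -> f <> 0 -> i \oc f <> 0.
Proof. by move=> i_mono f0 if0; apply: f0; apply: i_mono; rewrite comp0r. Qed.

Lemma epi_neq0 X Y Z (p : hom X Y) (f : hom Y Z) :
  is_epi p -> f <> 0 -> f \oc p <> 0.
Proof. by move=> p_epi f0 fp0; apply: f0; apply: p_epi; rewrite comp0l. Qed.

Lemma kernel_mono X Y K (f : hom X Y) (i : hom K X) : is_kernel f i -> is_mono i.
Proof.
case=> fi0 i_univ W g h igh.
have [|u [_ u_uniq]] := i_univ W (i \oc g).
  by rewrite comp_assoc fi0 comp0l.
by rewrite -(u_uniq g) // -(u_uniq h).
Qed.

Lemma zero_objP X : is_zero_obj X <-> idm X = 0.
Proof.
split=> [[] //|id0]; split=> Y f.
  by rewrite -[f]comp_idr id0 comp0r.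
by rewrite -[f]comp_idl id0 comp0l.
Qed.

Lemma simple_idm X : is_simple X -> idm X <> 0.
Proof. by case=> nz _ /zero_objP. Qed.

Lemma dim_hom_iso X X' Y Y' : isomorphic X X' -> isomorphic Y Y' ->
  \dim {: hom X Y} = \dim {: hom X' Y'}.
Proof.
have le (A A' B B' : C) : isomorphic A A' -> isomorphic B B' ->
    (\dim {: hom A B} <= \dim {: hom A' B'})%N; last first.
  by move=> XX' YY'; apply/anti_leq; rewrite !le //; exact: isomorphic_sym.
case=> f [f' [f'f ff']] [g [g' [g'g gg']]].
apply: (@dim_le_of_inj _ _ _ (fun h => g \oc (h \oc f'))) => [a u v|u v].
  by rewrite comp_linearl comp_linearr.
by move/(mono_of_retraction g'g)/(epi_of_section f'f).
Qed.

Lemma hom_direct_sum_neq0 r (Z : 'I_r -> C) Y X (f : hom X Y) :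
    is_direct_sum Z Y -> f <> 0 ->
  exists a (i : hom (Z a) Y) (p : hom Y (Z a)),
    p \oc i = idm (Z a) /\ p \oc f <> 0.
Proof.
case=> inj [prj [pi _ ip]] f0; apply: contrapT => no; apply: f0.
rewrite -[f]comp_idl -ip (lin_sum (comp_linearl f)) big1 // => a _.
rewrite -comp_assoc [_ \oc f](_ : _ = 0) ?comp0r //.
by apply: contrapT => ne0; apply: no; exists a, (inj a), (prj a).
Qed.

Hypothesis C_abelian : is_abelian C.

(** The kernel of [f] is a subobject of the simple object [X]: either it is zero, or it is all of
    [X] and then [f] vanishes. *)
Lemma simple_mono X Y (f : hom X Y) : is_simple X -> f <> 0 -> is_mono f.
Proof.
move=> [_ sX] f0; have [_ ker _ _ _] := C_abelian.
have [K [i ki]] := ker _ _ f; have [fi0 i_univ] := ki.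
have [[_ K0]|[g [_ ig]]] := sX _ _ (kernel_mono ki).
  move=> W u v fuv; apply/eqP; rewrite -subr_eq0; apply/eqP.
  have [|w [<- _]] := i_univ W (u - v).
    by rewrite (linB (comp_linearr f)) fuv subrr.
  by rewrite (K0 _ w) comp0r.
by case: f0; rewrite -[f]comp_idr -ig comp_assoc fi0 comp0l.
Qed.

Lemma schur X Y (f : hom X Y) : is_simple X -> is_simple Y -> f <> 0 -> is_iso f.
Proof.
move=> sX [_ sY] f0; have [/zero_objP X0|//] := sY _ _ (simple_mono sX f0).
by case: f0; rewrite -[f]comp_idr X0 comp0r.
Qed.

Hypothesis C_semisimple : is_semisimple C.

Lemma hom_neq0_simple X Y (f : hom X Y) : f <> 0 ->
  exists2 Z, is_simple Z &
    exists (i : hom Z Y) (p : hom Y Z), p \oc i = idm Z /\ p \oc f <> 0.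
Proof.
move=> f0; have [r [Z [sZ /hom_direct_sum_neq0 dY]]] := C_semisimple Y.
by have [a [i [p ip]]] := dY _ _ f0; exists (Z a) => //; exists i, p.
Qed.

(** Composition pairs Hom(X, Y) with Hom(Y, X) into End X, which is at most a line. It is
    nondegenerate on both sides: a nonzero morphism is nonzero on some simple summand of [Y], where
    Schur's lemma inverts it. *)
Lemma dim_hom_simple_sym X Y : is_simple X -> (\dim {: hom X X} <= 1)%N ->
  \dim {: hom X Y} = \dim {: hom Y X}.
Proof.
move=> sX X1; apply/anti_leq/andP; split.
  apply: (@dim_le_of_pairing _ _ _ _ (fun f g => g \oc f)) => //.
  - by move=> g; exact: comp_linearr.
  - by move=> f; exact: comp_linearl.
  move=> f f0; apply: contrapT => /hom_neq0_simple [Z sZ [i [p [_ pf0]]]].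
  have [g [gpf _]] := schur sX sZ pf0.
  by apply: (simple_idm sX); rewrite -gpf comp_assoc f0.
apply: (@dim_le_of_pairing _ _ _ _ (fun g f => g \oc f)) => //.
- by move=> f; exact: comp_linearl.
- by move=> g; exact: comp_linearr.
move=> g g0; apply: contrapT => gn0.
have idY0 : idm Y <> 0 by move=> idY0; apply: gn0; rewrite -[g]comp_idr idY0 comp0r.
have [r [Z [sZ [inj [prj [_ _ ip]]]]]] := C_semisimple Y.
apply: gn0; rewrite -[g]comp_idr -ip (lin_sum (comp_linearr g)) big1 // => a _.
rewrite comp_assoc [g \oc _](_ : _ = 0) ?comp0l //.
apply: contrapT => /(schur (sZ a) sX) [h [_ gih]].
by apply: (simple_idm sX); rewrite -gih -comp_assoc g0.
Qed.

End LinearCategory.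

(** * Eigenvectors and Schur's lemma over an algebraically closed field *)

Section Eigenvector.
Import VectorInternalTheory.

Lemma lfun_eigenvector {F : numClosedFieldType} {V : vectType F} (f : V -> V) :
  linear f -> (exists v : V, v <> 0) -> exists a (v : V), v <> 0 /\ f v = a *: v.
Proof.
move=> f_lin; rewrite -dim_neq0P dimvf -lt0n => V0.

pose A := lin1_mx (fun u => v2r (f (r2v u))).
have [a /eigenvalueP [u uA u0]] := eigenvalue_closed A V0.
exists a, (r2v u); split.
  by move=> ru0; move: u0; rewrite -[u]r2vK ru0 raddf0 eqxx.
apply: (can_inj v2rK); rewrite linearZ /= r2vK -uA /A.
have gl : linear (fun u : 'rV_(dim V) => v2r (f (r2v u))).
  by move=> c x y; rewrite linearP f_lin linearP.
pose g : {linear 'rV_(dim V) -> 'rV_(dim V)} :=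
  HB.pack (fun u : 'rV_(dim V) => v2r (f (r2v u)))
    (GRing.isLinear.Build F _ _ *:%R _ gl).
exact: esym (mul_rV_lin1 g u).
Qed.

End Eigenvector.

(** Composition with [f] on End X has an eigenvector [g], with eigenvalue [a]. Then [f - a *: idm X]
    kills [g], so it is not mono, and a non-mono endomorphism of a simple object is zero. *)
Lemma schur_endo {F : numClosedFieldType} {C : linear_category F} (X : C) :
  is_abelian C -> is_simple X -> \dim {: hom X X} = 1%N.
Proof.
move=> aC sX; have id0 := simple_idm sX.
apply/anti_leq/andP; split; last by rewrite lt0n; apply/dim_neq0P; exists (idm X).
suff le : ({: hom X X} <= <[idm X]>)%VS.
  by rewrite (leq_trans (dimvS le)) ?dim_vline ?leq_b1.
apply/subvP => f _.
have [|a [g [g0 fg]]] := lfun_eigenvector (@comp_linearr _ _ X X X f).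
  by exists (idm X).
suff -> : f = a *: idm X by rewrite memvZ ?memv_line.
apply/eqP; rewrite -subr_eq0; apply/eqP; apply: contrapT => h0.
apply: g0; apply: (simple_mono aC sX h0).
rewrite comp0r (linB (comp_linearl g)) fg (linZ (comp_linearl g)) comp_idl.
exact: subrr.
Qed.

(** * Coherence and duality in monoidal categories *)

Section Inverse.
Context {k : fieldType} {C : linear_category k}.
Implicit Types X Y Z : C.

(** Allows an equation between composites to be applied inside a longer chain kept associated to the
    right. *)
Lemma comp_rw X Y Z W (h : hom Y Z) (g : hom X Y) t :
  h \oc g = t -> forall f : hom W X, h \oc (g \oc f) = t \oc f.
Proof. by move=> <- f; rewrite comp_assoc. Qed.

Lemma comp_rw3 X Y Z W V (i : hom Z V) (h : hom Y Z) (g : hom X Y) t :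
  i \oc (h \oc g) = t ->
  forall f : hom W X, i \oc (h \oc (g \oc f)) = t \oc f.
Proof. by move=> <- f; rewrite !comp_assoc. Qed.

Lemma inverse_sym X Y (f : hom X Y) g : is_inverse f g -> is_inverse g f.
Proof. by case. Qed.

Lemma inverse_unique X Y (f : hom X Y) g g' :
  is_inverse f g -> is_inverse f g' -> g = g'.
Proof.
by move=> [gf _] [_ fg']; rewrite -[g]comp_idr -fg' comp_assoc gf comp_idl.
Qed.

Lemma inverse_comp X Y Z (f : hom X Y) f' (g : hom Y Z) g' :
  is_inverse f f' -> is_inverse g g' -> is_inverse (g \oc f) (f' \oc g').
Proof.
move=> [f'f ff'] [g'g gg']; split; rewrite -comp_assoc.
  by rewrite (comp_rw g'g) comp_idl.
by rewrite (comp_rw ff') comp_idl.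
Qed.

Lemma inverse_natural X X' Y Y' (f : hom X Y) f' (g : hom X' Y') g' a b :
    is_inverse f f' -> is_inverse g g' ->
  g \oc a = b \oc f -> g' \oc b = a \oc f'.
Proof.
move=> [_ ff'] [g'g _] ab.
by rewrite -[b]comp_idr -ff' (comp_assoc b) -ab !comp_assoc g'g comp_idl.
Qed.

End Inverse.

Section Monoidal.
Context {k : fieldType} {M : monoidal_category k}.
Implicit Types W X Y Z A B : M.

Lemma tensm_compr A X Y Z (g : hom Y Z) (f : hom X Y) :
  tensm (idm A) (g \oc f) = tensm (idm A) g \oc tensm (idm A) f.
Proof. by rewrite -tensm_comp comp_idl. Qed.

Lemma tensm_compl A X Y Z (g : hom Y Z) (f : hom X Y) :
  tensm (g \oc f) (idm A) = tensm g (idm A) \oc tensm f (idm A).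
Proof. by rewrite -tensm_comp comp_idl. Qed.

Lemma tensm_interchange X X' Y Y' (f : hom X X') (g : hom Y Y') :
  tensm f (idm Y') \oc tensm (idm X) g = tensm (idm X') g \oc tensm f (idm Y).
Proof. by rewrite -!tensm_comp !comp_idl !comp_idr. Qed.

Lemma inverse_tens X X' Y Y' (f : hom X X') f' (g : hom Y Y') g' :
  is_inverse f f' -> is_inverse g g' -> is_inverse (tensm f g) (tensm f' g').
Proof.
by move=> [f'f ff'] [g'g gg']; split; rewrite -tensm_comp ?f'f ?ff' ?g'g ?gg' tensm_id.
Qed.

Lemma inverse_idm X : is_inverse (idm X) (idm X).
Proof. by split; rewrite comp_idl. Qed.

Lemma isomorphic_refl X : isomorphic X X.
Proof. by exists (idm X), (idm X); exact: inverse_idm. Qed.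

Lemma isomorphic_tens X X' Y Y' :
  isomorphic X X' -> isomorphic Y Y' -> isomorphic (X \ox Y) (X' \ox Y').
Proof.
move=> [f [f' ff']] [g [g' gg']].
by exists (tensm f g), (tensm f' g'); exact: inverse_tens.
Qed.

Lemma isomorphic_runit X : isomorphic (X \ox tunit) X.
Proof. by exists (runit X), (runitV X); exact: runitK. Qed.

Lemma assocV_natural X X' Y Y' Z Z' (f : hom X X') (g : hom Y Y') (h : hom Z Z') :
  assocV X' Y' Z' \oc tensm f (tensm g h) = tensm (tensm f g) h \oc assocV X Y Z.
Proof.
exact: inverse_natural (assocK _ _ _) (assocK _ _ _) (assoc_natural _ _ _).
Qed.

Lemma lunitV_natural X X' (f : hom X X') :
  lunitV X' \oc f = tensm (idm tunit) f \oc lunitV X.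
Proof. exact: inverse_natural (lunitK _) (lunitK _) (lunit_natural _). Qed.

Lemma runitV_natural X X' (f : hom X X') :
  runitV X' \oc f = tensm f (idm tunit) \oc runitV X.
Proof. exact: inverse_natural (runitK _) (runitK _) (runit_natural _). Qed.

(** The left unitor is a natural isomorphism from tensoring with [tunit] to the identity functor. *)
Lemma tunit_faithful X Y (f g : hom X Y) :
  tensm (idm tunit) f = tensm (idm tunit) g -> f = g.
Proof.
move=> fg; have [_ lV] := lunitK X.
by rewrite -[f]comp_idr -[g]comp_idr -lV !comp_assoc -!lunit_natural fg.
Qed.

(* Kelly: the pentagon on (1, 1, X, Y) and the triangle imply the triangle for
   the left unitor. *)
Lemma lunit_tens X Y :
  lunit (X \ox Y) \oc assoc tunit X Y = tensm (lunit X) (idm Y).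
Proof.
apply: tunit_faithful.
have a_epi : is_epi (assoc tunit (tunit \ox X) Y
                       \oc tensm (assoc tunit tunit X) (idm Y)).
  have := inverse_comp (inverse_tens (assocK tunit tunit X) (inverse_idm Y))
            (assocK tunit (tunit \ox X) Y).
  by case=> _ /epi_of_section.
apply: a_epi; rewrite tensm_compr -!comp_assoc.
have := pentagon tunit tunit X Y; rewrite -!comp_assoc => <-.
rewrite (comp_rw (triangle _ _)) (comp_rw (esym (assoc_natural _ _ _))) -comp_assoc.
rewrite -[idm (X \ox Y)]tensm_id -assoc_natural.
by rewrite -tensm_compl triangle.
Qed.

Lemma lunit_tensE X Y :
  lunit (X \ox Y) = tensm (lunit X) (idm Y) \oc assocV tunit X Y.
Proof. by rewrite -lunit_tens -comp_assoc (assocK _ _ _).2 comp_idr. Qed.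

Lemma lunitV_tens X Y :
  lunitV (X \ox Y) = assoc tunit X Y \oc tensm (lunitV X) (idm Y).
Proof.
apply: inverse_unique (lunitK _) _; rewrite lunit_tensE.
apply: inverse_comp (inverse_sym (assocK _ _ _)) _.
exact: inverse_tens (lunitK X) (inverse_idm Y).
Qed.

Lemma triangleV X Y :
  assocV X tunit Y \oc tensm (idm X) (lunitV Y) = tensm (runitV X) (idm Y).
Proof.
apply: inverse_unique (inverse_tens (runitK X) (inverse_idm Y)).
rewrite -triangle; apply: inverse_comp (assocK _ _ _) _.
exact: inverse_tens (inverse_idm X) (lunitK Y).
Qed.

Lemma pentagon_assocV W X Y Z :
  tensm (idm W) (assocV X Y Z) \oc (assoc W X (Y \ox Z) \oc assoc (W \ox X) Y Z)
    = assoc W (X \ox Y) Z \oc tensm (assoc W X Y) (idm Z).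
Proof.
rewrite pentagon -!comp_assoc (comp_rw (esym (tensm_compr _ _ _))).
by rewrite (assocK X Y Z).1 tensm_id comp_idl.
Qed.

(** Both sides are inverse to the isomorphism that appears in [pentagon_assocV]. *)
Lemma pentagonV W X Y Z :
  assocV (W \ox X) Y Z \oc (assocV W X (Y \ox Z) \oc tensm (idm W) (assoc X Y Z))
    = tensm (assocV W X Y) (idm Z) \oc assocV W (X \ox Y) Z.
Proof.
apply: (@inverse_unique _ _ _ _ (assoc W (X \ox Y) Z \oc tensm (assoc W X Y) (idm Z))).
  rewrite -pentagon_assocV (comp_assoc (assocV (W \ox X) Y Z)); apply: inverse_comp.
    by apply: inverse_comp; exact: assocK.
  by apply: inverse_tens (inverse_idm W) _; exact/inverse_sym/assocK.
apply: inverse_comp (assocK _ _ _).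
exact: inverse_tens (assocK _ _ _) (inverse_idm Z).
Qed.

(** The adjunction between tensoring with [Xd] and tensoring with [X]: [phi] and [psi] are the
    transposes built from [coev] and [ev], and each triangle identity gives one of the two
    cancellations. *)
Lemma dim_hom_dual X Xd A B : is_left_dual X Xd ->
  \dim {: hom (Xd \ox A) B} = \dim {: hom A (X \ox B)}.
Proof.
case=> ev [coev [zigX]]; rewrite -!comp_assoc in zigX * => zigXd.
pose phi (g : hom (Xd \ox A) B) : hom A (X \ox B) :=
  tensm (idm X) g \oc (assoc X Xd A \oc (tensm coev (idm A) \oc lunitV A)).
pose psi (f : hom A (X \ox B)) : hom (Xd \ox A) B :=
  lunit B \oc (tensm ev (idm B) \oc (assocV Xd X B \oc tensm (idm Xd) f)).
(* Naturality moves [g] to the outside; the remaining endomorphism of [Xd \ox A] is the left-hand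
   side of [zigXd] tensored with [A]. *)
have phiK : cancel phi psi.
  move=> g; rewrite /psi /phi.
  rewrite tensm_compr (comp_rw (assocV_natural _ _ _)) tensm_id.
  rewrite -comp_assoc (comp_rw (tensm_interchange _ _)) -!comp_assoc.
  rewrite (comp_rw (lunit_natural _)) -comp_assoc.
  rewrite -[RHS]comp_idr; congr (_ \oc _).
  rewrite lunit_tensE -comp_assoc -[idm (Xd \ox A)]tensm_id.
  rewrite (comp_rw (assocV_natural _ _ _)) -comp_assoc !tensm_compr.
  rewrite (comp_rw3 (pentagonV _ _ _ _)) -comp_assoc.
  rewrite (comp_rw (assocV_natural _ _ _)) -comp_assoc triangleV.
  by rewrite -!tensm_compl zigXd.
(* Symmetrically, [f] moves to the inside and leaves the left-hand side of [zigX] tensored with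
   [B]. *)
have psiK : cancel psi phi.
  move=> f; rewrite /psi /phi.
  rewrite !tensm_compr -!comp_assoc (comp_rw (esym (assoc_natural _ _ _))).
  rewrite tensm_id -comp_assoc (comp_rw (esym (tensm_interchange _ _))).
  rewrite -comp_assoc -lunitV_natural !comp_assoc.
  rewrite -[RHS]comp_idl; congr (_ \oc _); rewrite -!comp_assoc.
  rewrite lunitV_tens -[idm (X \ox B)]tensm_id.
  rewrite (comp_rw (esym (assoc_natural _ _ _))) -comp_assoc.
  rewrite (comp_rw3 (pentagon_assocV _ _ _ _)) -comp_assoc.
  rewrite (comp_rw (esym (assoc_natural _ _ _))) -comp_assoc.
  by rewrite (comp_rw (triangle _ _)) -!tensm_compl zigX.
have phi_lin : linear phi.
  by move=> a g g'; rewrite /phi tens_linearr comp_linearl.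
have psi_lin : linear psi.
  by move=> a f f'; rewrite /psi tens_linearr !comp_linearr.
apply/anti_leq.
rewrite (dim_le_of_inj phi_lin (can_inj phiK)).
by rewrite (dim_le_of_inj psi_lin (can_inj psiK)).
Qed.
End Monoidal.

(** * Grothendieck rings of fusion categories *)

Section FusionCategory.
Context {F : numClosedFieldType} {C : fusion_category F}.
Implicit Types X Y Z W A B : C.

Let C_abelian : is_abelian C := fusion_abelian C.
Let C_semisimple : is_semisimple C := @fusion_semisimple F C.

(* Since Hom(X* (x) X, 1) = End X is a line, [ev \o (p (x) 1)] is a multiple of
   [ev] for every endomorphism [p] of X*, and then [p] is a scalar. *)
Lemma dual_simple X : is_simple X -> exists2 Z, is_simple Z & isomorphic (dual X) Z.
Proof.
move=> sX; have dX := dualP X.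
have ev_dim : \dim {: hom (dual X \ox X) tunit} = 1%N.
  rewrite (dim_hom_dual _ _ dX) -(schur_endo C_abelian sX).
  exact: dim_hom_iso (isomorphic_refl X) (isomorphic_runit X).
case: dX => ev [coev [zigX zigXd]].
have ev0 : ev <> 0.
  move=> ev0; apply: (simple_idm sX); rewrite -zigX ev0.
  by rewrite (lin0 (tens_linearr _)) comp0r !comp0l.
have evP g : exists c, g = c *: ev.
  apply/vlineP; suff -> : (<[ev]> = fullv)%VS by exact: memvf.
  by apply/eqP; rewrite eqEdim subvf ev_dim dim_vline; move/eqP: ev0 => ->.
have scalar (p : hom (dual X) (dual X)) : exists c, p = c *: idm (dual X).
  have [c evp] := evP (ev \oc tensm p (idm X)); exists c.
  (* Insert [p] into the zigzag and slide it along until it meets [ev], where [evp] replaces it by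
     the scalar [c]. *)
  rewrite -[LHS]comp_idl -[X in X \oc p]zigXd -[X in _ *: X]zigXd -!comp_assoc.
  rewrite runitV_natural (comp_rw (esym (tensm_interchange _ _))) -comp_assoc.
  rewrite -[idm (X \ox dual X)]tensm_id (comp_rw (assocV_natural _ _ _)) -comp_assoc.
  rewrite (comp_rw (esym (tensm_compl _ _ _))) evp.
  rewrite (linZ (tens_linearl _)) (linZ (comp_linearl _)).
  by rewrite (linZ (comp_linearr _)).
have id0 : idm (dual X) <> 0.
  move=> id0; apply: ev0; rewrite -[ev]comp_idr -tensm_id id0.
  by rewrite (lin0 (tens_linearl _)) comp0r.
have [Z sZ [i [p [pi _]]]] := hom_neq0_simple C_semisimple id0.
exists Z => //; exists p, i; split=> //.
(* The idempotent cutting out the simple summand [Z] is a scalar; composing it with [p], which is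
   nonzero, shows that the scalar is 1, so [Z] is the whole dual. *)
have [c ip] := scalar (i \oc p); suff c1 : c = 1 by rewrite ip c1 scale1r.
have : (c - 1) *: p = 0.
  rewrite scalerBl scale1r -{1}[p]comp_idr -(linZ (comp_linearr p)) -ip.
  by rewrite comp_assoc pi comp_idl subrr.
move/eqP; rewrite scaler_eq0 => /orP[/eqP/subr0_eq//|/eqP p0].
by case: (simple_idm sZ); rewrite -pi p0 comp0l.
Qed.

(** * Multiplicities of the simple objects, duality on indices, and the adjoint subcategory *)

Section Representatives.
Context {n : nat} {X : 'I_n.+1 -> C}.
Hypothesis hX : simple_representatives X.

Let X0 : X ord0 = tunit. Proof. by case: hX. Qed.
Let X_simple i : is_simple (X i). Proof. by case: hX. Qed.
Let X_inj i j : isomorphic (X i) (X j) -> i = j.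
Proof. by case: hX => _ _ + _; apply. Qed.
Let X_onto Y : is_simple Y -> exists i, isomorphic Y (X i).
Proof. by case: hX => _ _ _; apply. Qed.

Lemma mult_iso Y Z i : isomorphic Y Z -> mult X Y i = mult X Z i.
Proof. exact: dim_hom_iso (isomorphic_refl _). Qed.

Lemma mult_sym Y i : mult X Y i = \dim {: hom Y (X i)}.
Proof. by apply: dim_hom_simple_sym; rewrite ?schur_endo. Qed.

Lemma mult_simple i j : mult X (X i) j = (j == i).
Proof.
have [->|ji] := eqVneq; first exact: schur_endo.
apply/eqP; apply: contraNT ji => /dim_neq0P [f f0].
by apply/eqP/X_inj; exists f; exact: schur.
Qed.

Lemma mult_tunit j : mult X tunit j = (j == ord0).
Proof. by rewrite -X0 mult_simple. Qed.

Lemma mult_direct_sum r (Z : 'I_r -> C) Y i :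
  is_direct_sum Z Y -> mult X Y i != 0%N -> exists a, mult X (Z a) i != 0%N.
Proof.
move=> dY /dim_neq0P [f /(hom_direct_sum_neq0 dY) [a [_ [p [_ pf0]]]]].
by exists a; apply/dim_neq0P; exists (p \oc f).
Qed.

Lemma mult_mono Y Z (f : hom Y Z) i :
  is_mono f -> mult X Y i != 0%N -> mult X Z i != 0%N.
Proof.
move=> f_mono /dim_neq0P [g g0]; apply/dim_neq0P.
by exists (f \oc g); exact: mono_neq0.
Qed.

Lemma mult_epi Y Z (f : hom Y Z) i :
  is_epi f -> mult X Z i != 0%N -> mult X Y i != 0%N.
Proof.
rewrite !mult_sym => f_epi /dim_neq0P [g g0]; apply/dim_neq0P.
by exists (g \oc f); exact: epi_neq0.
Qed.

(** A linear functor [T] preserves the decomposition of [Y] into simples, so a nonzero morphism to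
    [T Y] has a nonzero component. Stating it for a general [T] covers tensoring on either side. *)
Lemma hom_constituent Y A (T : C -> C)
    (Tm : forall Z Z', hom Z Z' -> hom (T Z) (T Z')) :
    (forall Z Z', linear (@Tm Z Z')) -> (forall Z, Tm _ _ (idm Z) = idm (T Z)) ->
    (forall Z Z' Z'' (g : hom Z' Z'') (f : hom Z Z'),
       Tm _ _ (g \oc f) = Tm _ _ g \oc Tm _ _ f) ->
    (\dim {: hom A (T Y)} != 0)%N ->
  exists2 b, mult X Y b != 0%N & (\dim {: hom A (T (X b))} != 0)%N.
Proof.
move=> Tlin Tid Tcomp /dim_neq0P [f f0].
have [r [Z [sZ [inj [prj [pi _ ip]]]]]] := C_semisimple Y.
apply: contrapT => no; apply: f0.
rewrite -[f]comp_idl -Tid -ip (lin_sum (Tlin _ _)) (lin_sum (comp_linearl f)).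
rewrite big1 // => a _.
rewrite Tcomp -comp_assoc [_ \oc f](_ : _ = 0) ?comp0r //.
apply: contrapT => f0; apply: no; have [b [g [g' [g'g gg']]]] := X_onto (sZ a).
exists b; apply/dim_neq0P.
  exists (inj a \oc g') => ig0; apply: (simple_idm (sZ a)).
  by rewrite -(pi a) -[inj a]comp_idr -g'g [inj a \oc _]comp_assoc ig0 comp0l comp0r.
exists (Tm _ _ g \oc (Tm _ _ (prj a) \oc f)); apply: mono_neq0 => //.
by apply: (@mono_of_retraction _ _ _ _ _ (Tm _ _ g')); rewrite -Tcomp g'g Tid.
Qed.

Lemma hom_tensl_constituent A Y W : (\dim {: hom A (Y \ox W)} != 0)%N ->
  exists2 b, mult X Y b != 0%N & (\dim {: hom A (X b \ox W)} != 0)%N.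
Proof.
apply: (@hom_constituent Y A (fun Z => Z \ox W) (fun Z Z' f => tensm f (idm W))).
- by move=> Z Z'; exact: tens_linearl.
- by move=> Z; exact: tensm_id.
- by move=> Z Z' Z'' g f; exact: tensm_compl.
Qed.

Lemma hom_tensr_constituent A Y W : (\dim {: hom A (W \ox Y)} != 0)%N ->
  exists2 b, mult X Y b != 0%N & (\dim {: hom A (W \ox X b)} != 0)%N.
Proof.
apply: (@hom_constituent Y A (fun Z => W \ox Z) (fun Z Z' f => tensm (idm W) f)).
- by move=> Z Z'; exact: tens_linearr.
- by move=> Z; exact: tensm_id.
- by move=> Z Z' Z'' g f; exact: tensm_compr.
Qed.

(** Reads off the constituents of [dual Y] from a tensor product with [Y], so that they can be
    traced back to those of [Y] although [dual] is only given on objects. *)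
Lemma dim_hom_tunit Y i : \dim {: hom tunit (Y \ox X i)} = mult X (dual Y) i.
Proof.
rewrite -(dim_hom_dual _ _ (dualP Y)) mult_sym.
exact: dim_hom_iso (isomorphic_runit _) (isomorphic_refl _).
Qed.

Lemma exists_dual_index : exists s : 'I_n.+1 -> 'I_n.+1,
  forall i, isomorphic (dual (X i)) (X (s i)).
Proof.
have [i|s sP] := @choice _ _ (fun i j => isomorphic (dual (X i)) (X j)).
  have [Z /X_onto [j Zj] dZ] := dual_simple (X_simple i).
  by exists j; exact: isomorphic_trans dZ Zj.
by exists s.
Qed.

Lemma gmul_simple (R : comNzRingType) i j :
  gmul X (gsimple i) (gsimple j) = gclass X R (X i \ox X j).
Proof.
rewrite /gmul (bigD1 i) //= (bigD1 j) //= [X in _ + X]big1 => [|l li].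
  rewrite big1 => [|l lj]; first by rewrite !mxE !eqxx mulr1 scale1r !addr0.
  by rewrite !mxE (negPf lj) andbF mulr0 scale0r.
by rewrite big1 // => m _; rewrite !mxE (negPf li) andbF mul0r scale0r.
Qed.

Lemma mult_comm : groth_commutative X ->
  forall i j l, mult X (X i \ox X j) l = mult X (X j \ox X i) l.
Proof.
move=> comm i j l; have := comm (gsimple i) (gsimple j).
by rewrite !gmul_simple => /rowP/(_ l); rewrite !mxE => /eqP; rewrite eqr_nat => /eqP.
Qed.

Section DualIndex.
Variable s : 'I_n.+1 -> 'I_n.+1.
Hypothesis sP : forall i, isomorphic (dual (X i)) (X (s i)).

Lemma mult_dual i j : mult X (dual (X i)) j = (j == s i).
Proof. by rewrite (mult_iso _ (sP i)) mult_simple. Qed.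

(** Frobenius reciprocity: the adjunction of [dual_hom] type from [dim_hom_dual], combined with the
    symmetry [mult_sym]. *)
Lemma mult_frobenius i j l : mult X (X i \ox X j) l = mult X (X (s i) \ox X l) j.
Proof.
rewrite [RHS]mult_sym /mult -(dim_hom_dual _ _ (dualP (X i))).
exact: dim_hom_iso (isomorphic_tens (sP i) (isomorphic_refl _)) (isomorphic_refl _).
Qed.

Lemma mult_ord0 i j : mult X (X i \ox X j) ord0 = (j == s i).
Proof.
rewrite mult_frobenius X0 -mult_simple.
exact/mult_iso/isomorphic_runit.
Qed.

(** The unit occurs in [X i \ox X (s i)], hence by commutativity in [X (s i) \ox X i], which
    identifies [i] as the dual index of [s i]. *)
Lemma dual_index_involutive : groth_commutative X -> involutive s.
Proof.
move=> comm i; have := mult_ord0 i (s i).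
rewrite mult_comm // mult_ord0 eqxx; by case: eqP.
Qed.

Lemma adjoint_tunit : adjoint_subcategory X tunit.
Proof. by move=> D [D1 _ _ _ _] _. Qed.

Lemma adjoint_tens Y Z : adjoint_subcategory X Y -> adjoint_subcategory X Z ->
  adjoint_subcategory X (Y \ox Z).
Proof.
move=> aY aZ D DD Dad; have [_ Dt _ _ _] := DD.
by apply: Dt; [exact: aY|exact: aZ].
Qed.

Lemma adjoint_dual Y : adjoint_subcategory X Y -> adjoint_subcategory X (dual Y).
Proof. by move=> aY D DD Dad; have [_ _ Dd _ _] := DD; apply: Dd; exact: aY. Qed.

Lemma adjoint_constituent Y l : adjoint_subcategory X Y -> mult X Y l != 0%N ->
  adjoint_subcategory X (X l).
Proof.
move=> aY /dim_neq0P [f f0] D DD Dad; have [_ _ _ _ [Dm _]] := DD.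
by apply: (Dm _ _ f); [exact: simple_mono|exact: aY].
Qed.

Lemma adjoint_iso Y l : isomorphic Y (X l) -> adjoint_subcategory X Y ->
  adjoint_subcategory X (X l).
Proof.
move=> Yl aY; apply: adjoint_constituent aY _.
by rewrite (mult_iso _ Yl) mult_simple eqxx.
Qed.

Lemma adjoint_mul_dual i l : mult X (X i \ox X (s i)) l != 0%N ->
  adjoint_subcategory X (X l).
Proof.
rewrite -(mult_iso _ (isomorphic_tens (isomorphic_refl (X i)) (sP i))).
by apply: adjoint_constituent => D _; apply.
Qed.

(** The objects all of whose simple constituents satisfy [P] form a fusion subcategory containing
    every [X i \ox dual (X i)]. This turns the minimality of the adjoint subcategory into an
    induction principle on indices. *)
Lemma adjoint_minimal (P : 'I_n.+1 -> Prop) :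
    P ord0 ->
    (forall i j l, P i -> P j -> mult X (X i \ox X j) l != 0%N -> P l) ->
    (forall i, P i -> P (s i)) ->
    (forall i l, mult X (X i \ox X (s i)) l != 0%N -> P l) ->
  forall i, adjoint_subcategory X (X i) -> P i.
Proof.
move=> P0 Pm Ps Pad i ai.
pose D : set C := fun Y => forall l, mult X Y l != 0%N -> P l.
suff Di : D (X i) by apply: Di; rewrite mult_simple eqxx.
apply: ai => [|j l]; last first.
  rewrite (mult_iso _ (isomorphic_tens (isomorphic_refl (X j)) (sP j))); exact: Pad.
split.
- by move=> l; rewrite mult_tunit; have [->|] := eqVneq l ord0.
- move=> Y Z DY DZ l /hom_tensl_constituent [a Ya] /hom_tensr_constituent [b Zb].
  exact: Pm (DY a Ya) (DZ b Zb).
- move=> Y DY l; rewrite -dim_hom_tunit => /hom_tensl_constituent [a Ya].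
  by rewrite dim_hom_tunit mult_dual; have [-> _|//] := eqVneq l (s a); exact/Ps/DY.
- by move=> r Z Y DZ dY l /(mult_direct_sum dY) [a] /DZ.
by split=> Y Z f f_inj DY l; [move/(mult_mono f_inj)/DY|move/(mult_epi f_inj)/DY].
Qed.

End DualIndex.
End Representatives.
End FusionCategory.

(** * Frobenius-Perron dimensions *)

Lemma char_poly_trmx (R : comNzRingType) m (A : 'M[R]_m) :
  char_poly A^T = char_poly A.
Proof.
rewrite /char_poly -det_tr; congr (\det _); apply/matrixP => i j.
by rewrite !mxE eq_sym.
Qed.

Section FPdim.
Context {R : realType} {C : fusion_category R[i]} {n : nat} {X : 'I_n.+1 -> C}.
Hypothesis hX : simple_representatives X.
Variable s : 'I_n.+1 -> 'I_n.+1.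
Hypothesis sP : forall i, isomorphic (dual (X i)) (X (s i)).

Lemma FPdim_dual_index i : FPdim X (X (s i)) = FPdim X (X i).
Proof.
rewrite /FPdim (_ : leftmult_mx X (X (s i)) = (leftmult_mx X (X i))^T).
  by congr sup; apply/seteqP; split=> a /=;
    rewrite !eigenvalue_root_char char_poly_trmx.
by apply/matrixP => j l; rewrite !mxE [in RHS](mult_frobenius hX sP).
Qed.

Lemma FPdim_ge0 Y : 0 <= FPdim X Y.
Proof.
rewrite /FPdim; set E := (X in sup X).
(* When the set has no supremum, [sup] takes its default value 0; otherwise it dominates a
   nonnegative element. *)
have [E_sup|/sup_out -> //] := pselect (has_sup E).
have [[a Ea] _] := E_sup; apply: (le_trans Ea.1).
exact: sup_upper_bound E_sup _ Ea.
Qed.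

End FPdim.

(** * Characters *)

Section StructureConstants.
Context {F : numClosedFieldType} {n : nat}.
Variable N : 'I_n.+1 -> 'I_n.+1 -> 'I_n.+1 -> nat.

(** A unital algebra morphism recorded by its values on the simple classes; only the structure
    constants [N] remain of the category. *)
Definition is_ring_character (u : 'I_n.+1 -> F) : Prop :=
  u ord0 = 1 /\ forall i j, u i * u j = \sum_l (N i j l)%:R * u l.

Variable d : 'I_n.+1 -> F.
Hypothesis d_gt0 : forall i, 0 < d i.
Hypothesis d_char : is_ring_character d.

(* Compare both sides of [u i * u j = \sum_l N i j l * u l] at an index [j]
   maximising [`|u j| / d j]. *)
Lemma ring_character_norm_le u i : is_ring_character u -> `|u i| <= d i.
Proof.
move=> [u0 uM]; pose r l := `|u l| / d l.
have r_real l : r l \is Num.real.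
  by rewrite ger0_real // divr_ge0 // ltW.
(* The order on [F] is partial; a maximum exists because the ratios are real, hence pairwise
   comparable. *)
have [j _ r_max] : extremum_spec >=%O xpredT r [arg max_(j > ord0) r j]%O.
  by apply: comparable_arg_maxP => // j l _ _; exact: real_comparable.
have r_gt0 : 0 < r j.
  apply: lt_le_trans (r_max ord0 _) => //.
  by rewrite /r u0 normr1 divr_gt0.
have uj_gt0 : 0 < `|u j| by move: r_gt0; rewrite /r pmulr_lgt0 ?invr_gt0.
rewrite -(ler_pM2r uj_gt0) -normrM uM.
apply: (le_trans (ler_norm_sum _ _ _)).
(* Write the norm of [u j] as [r j * d j] and expand [d i * d j], since [d] is itself a
   character. *)
have -> : d i * `|u j| = \sum_l (N i j l)%:R * (r j * d l).
  under eq_bigr do rewrite mulrCA.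
  rewrite -mulr_sumr -d_char.2 /r mulrCA; congr (_ * _).
  by rewrite divfK // gt_eqF.
apply: ler_sum => l _; rewrite normrM normr_nat ler_wpM2l ?ler0n //.
by rewrite -ler_pdivrMr //; exact: r_max.
Qed.

(** Equality case of the triangle inequality: each term of the expansion of [u i * u j] is bounded
    in norm by the matching term for [d], and the two sums agree, so the terms agree. *)
Lemma ring_character_constituent u i j l : is_ring_character u ->
  u i * u j = d i * d j -> N i j l != 0%N -> u l = d l.
Proof.
move=> uC; rewrite uC.2 d_char.2 => e Nl.
have N0 : (N i j l)%:R != 0 :> F by rewrite pnatr_eq0.
apply: (mulfI N0); apply: (normC_sum_upper _ e) => // m _.
by rewrite normrM normr_nat ler_wpM2l ?ler0n ?ring_character_norm_le.
Qed.

Variable s : 'I_n.+1 -> 'I_n.+1.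
Hypothesis s_inv : involutive s.
Hypothesis d_s : forall i, d (s i) = d i.
Hypothesis N_frobenius : forall i j l, N i j l = N (s i) l j.

Variable ad : pred 'I_n.+1.
Hypothesis ad0 : ad ord0.
Hypothesis ad_mul : forall i j l, ad i -> ad j -> N i j l != 0%N -> ad l.
Hypothesis ad_s : forall i, ad i -> ad (s i).
Hypothesis ad_mul_s : forall i l, N i (s i) l != 0%N -> ad l.
Hypothesis ad_minimal : forall P : 'I_n.+1 -> Prop,
  P ord0 -> (forall i j l, P i -> P j -> N i j l != 0%N -> P l) ->
  (forall i, P i -> P (s i)) -> (forall i l, N i (s i) l != 0%N -> P l) ->
  forall i, ad i -> P i.

(** Forwards, the indices where [u] and [d] agree satisfy the closure conditions of [ad_minimal].
    Backwards, every constituent in the expansion of [u i * u (s i)] is adjoint. *)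
Lemma ring_character_ad_trivialP u : is_ring_character u ->
  (forall i, u i * u (s i) = d i ^+ 2) <-> (forall i, ad i -> u i = d i).
Proof.
move=> uC; split=> [u2|u_ad i].
  apply: ad_minimal => [|i j l ui uj|i ui|i l].
  - by rewrite uC.1 d_char.1.
  - by apply: ring_character_constituent => //; rewrite ui uj.
  - by apply: (mulfI (lt0r_neq0 (d_gt0 i))); rewrite d_s -{1}ui u2.
  by apply: ring_character_constituent; rewrite // u2 d_s expr2.
rewrite uC.2 expr2 -{2}d_s d_char.2; apply: eq_bigr => l _.
have [->|Nl] := eqVneq (N i (s i) l) 0%N; first by rewrite !mul0r.
by rewrite u_ad //; exact: ad_mul_s Nl.
Qed.

Lemma ring_character_prod_sqr u : (forall i, u i * u (s i) = d i ^+ 2) ->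
  (\prod_i (u i / d i)) ^+ 2 = 1.
Proof.
move=> u2; rewrite expr2 {2}(reindex_inj (inv_inj s_inv)) /= -big_split /=.
apply: big1 => i _; rewrite d_s mulrACA u2 -expr2 -exprMn divff ?expr1n //.
exact: lt0r_neq0.
Qed.

(* \sum_(i | ad i) d i * x_i is the regular element of the adjoint subring. *)
Lemma ring_character_regular u k : is_ring_character u -> ad k ->
  u k * (\sum_(i | ad i) d i * u i) = d k * (\sum_(i | ad i) d i * u i).
Proof.
move=> uC adk; rewrite !mulr_sumr.
transitivity (\sum_l \sum_(i | ad i) (N k i l)%:R * d i * u l).
  rewrite exchange_big /=; apply: eq_bigr => i _.
  rewrite mulrCA uC.2 mulr_sumr; apply: eq_bigr => l _.
  by rewrite mulrA [d i * _]mulrC.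
rewrite [RHS]big_mkcond /=; apply: eq_bigr => l _.
rewrite -mulr_suml; case: ifPn => adl; last first.
  rewrite big1 ?mul0r // => i adi.
  have [->|Nl] := eqVneq (N k i l) 0%N; first by rewrite mul0r.
  by rewrite (ad_mul adk adi Nl) in adl.
(* Expand [d (s k) * d l]; reciprocity matches its coefficients with [N k i l], and for adjoint [k]
   and [l] only adjoint [i] contribute. *)
rewrite mulrA -[d k]d_s d_char.2 big_mkcond /=; congr (_ * _).
apply: eq_bigr => i _; rewrite N_frobenius; case: ifPn => // adi.
have [->|Nl] := eqVneq (N (s k) l i) 0%N; first by rewrite mul0r.
by rewrite (ad_mul (ad_s adk) adl Nl) in adi.
Qed.

(** A nonzero sum could be cancelled in [ring_character_regular], forcing [u] and [d] to agree on
    all adjoint indices. *)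
Lemma ring_character_sum_ad0 u : is_ring_character u ->
  ~ (forall i, ad i -> u i = d i) -> \sum_(i | ad i) d i * u i = 0.
Proof.
move=> uC; apply: contra_notP => S0 i adi; apply: (mulIf (introN eqP S0)).
exact: ring_character_regular.
Qed.

Lemma ring_character_sum_ad u : (forall i, ad i -> u i = d i) ->
  \sum_(i | ad i) d i * u i = \sum_(i | ad i) d i ^+ 2.
Proof. by move=> u_ad; apply: eq_bigr => i /u_ad ->; rewrite expr2. Qed.

Lemma sum_ad_gt0 : 0 < \sum_(i | ad i) d i ^+ 2.
Proof.
rewrite (bigD1 ord0) //= ltr_pwDl ?exprn_gt0 ?sumr_ge0 // => i _.
by rewrite exprn_ge0 // ltW.
Qed.

End StructureConstants.

(** * Linear independence of the algebra morphisms and separation of points *)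

Section Characters.
Context {R : realType} {C : fusion_category R[i]} {n : nat} {X : 'I_n.+1 -> C}.
Local Notation K_C := 'rV[R[i]]_n.+1.
Local Notation K_C_dual := 'Hom('rV[R[i]]_n.+1, R[i]^o).
Implicit Types (f g : K_C_dual) (a b : K_C).

Lemma functionalE f a : f a = \sum_i a 0 i * f (gsimple i).
Proof.
rewrite {1}[a]row_sum_delta linear_sum; apply: eq_bigr => i _.
by rewrite linearZ.
Qed.

Lemma functional_gclass f Y :
  f (gclass X _ Y) = \sum_i (mult X Y i)%:R * f (gsimple i).
Proof. by rewrite functionalE; apply: eq_bigr => i _; rewrite mxE. Qed.

Lemma functional_ext f g : (forall i, f (gsimple i) = g (gsimple i)) -> f = g.
Proof.
move=> fg; apply/lfunP => a; rewrite !functionalE.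
by apply: eq_bigr => i _; rewrite fg.
Qed.

Lemma algebra_morphism_prod f (I : Type) (r : seq I) (P : pred I) (E : I -> K_C) :
    is_algebra_morphism X f ->
  f (\big[gmul X/gone X _]_(i <- r | P i) E i) = \prod_(i <- r | P i) f (E i).
Proof. by case=> f1 fM; exact: (big_morph f fM f1). Qed.

Variable mu : n.+1.-tuple K_C_dual.
Hypothesis hmu : is_character_list X mu.

Lemma tnth_morphism j : is_algebra_morphism X (tnth mu j).
Proof. by case: hmu => _ _ muP; apply/muP/mem_tnth. Qed.

(* The product over [j != l] of [a_j - mu_j(a_j)] is killed by every [mu_j] except
   [mu_l], as soon as [a_j] separates [mu_j] from [mu_l]. *)
Lemma character_list_free : free mu.
Proof.
have [_ mu_uniq _] := hmu; apply/freeP => c c0 l.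
(* The condition [j != l] sits under the quantifier so that [choice] yields a total function; at [l]
   the value is the dummy 0. *)
have sep j : exists a, j != l -> tnth mu j a != tnth mu l a.
  have [->|jl] := eqVneq j l; first by exists 0.
  have : tnth mu j != tnth mu l by rewrite (inj_eq (tuple_uniqP _ mu_uniq)).
  by move/eqP/lfunP/existsNP => [a /eqP aP]; exists a.
have [a aP] := choice sep.
pose e := \big[gmul X/gone X _]_(j | j != l) (a j - tnth mu j (a j) *: gone X _).
have eE j : tnth mu j e = \prod_(i | i != l) (tnth mu j (a i) - tnth mu i (a i)).
  rewrite algebra_morphism_prod; last exact: tnth_morphism.
  apply: eq_bigr => i _; rewrite linearB linearZ /= (tnth_morphism j).1.
  by rewrite [_ *: 1]mulr1.
have := congr1 (fun f : K_C_dual => f e) c0.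
rewrite /= sum_lfunE (bigD1 l) //= big1 => [|j jl].
  rewrite addr0 lfunE /= -tnth_nth eE zero_lfunE => /eqP.
  rewrite scaler_eq0 => /orP[/eqP//|/prodf_eq0 [i il]].
  by rewrite subr_eq0 eq_sym (negPf (aP i il)).
rewrite scale_lfunE -tnth_nth eE (bigD1 j) //= subrr mul0r; exact: scaler0.
Qed.

(** A free family of [n.+1] functionals is a basis of the dual space, so every coordinate form is a
    combination of the characters. *)
Lemma character_list_separates a b :
  (forall j, tnth mu j a = tnth mu j b) -> a = b.
Proof.
move=> ab.
have mu_basis : basis_of fullv mu.
  rewrite basisEfree character_list_free subvf size_tuple.
  have -> : \dim {: K_C_dual} = (1 * n.+1 * 1)%N by exact: dimvf.
  by rewrite muln1 mul1n ltnSn.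
apply/rowP => l; have lE (c : K_C) : c 0 l = linext (fun i => (i == l)%:R) c.
  rewrite functionalE (bigD1 l) //= linextE eqxx mulr1 big1 ?addr0 // => i il.
  by rewrite linextE (negPf il) mulr0.
rewrite !lE (coord_basis mu_basis (memvf (linext _))) !sum_lfunE.
by apply: eq_bigr => j _; rewrite !lfunE /= -!tnth_nth ab.
Qed.

End Characters.

(** * Grouplike characters and the dual-Burnside identity *)

Section DualBurnside.
Context {R : realType} {C : fusion_category R[i]} {n : nat} {X : 'I_n.+1 -> C}.
Hypothesis hX : simple_representatives X.
Hypothesis hcomm : groth_commutative X.
Variable mu : n.+1.-tuple 'Hom('rV[R[i]]_n.+1, R[i]^o).
Hypothesis hmu : is_character_list X mu.
Variable s : 'I_n.+1 -> 'I_n.+1.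
Hypothesis sP : forall i, isomorphic (dual (X i)) (X (s i)).

Local Notation N := (fun i j l => mult X (X i \ox X j) l).
Local Notation d := (dim_simple X).
Local Notation ad := (fun i => `[< adjoint_subcategory X (X i) >]).

Lemma algebra_morphism_ring_character f : is_algebra_morphism X f ->
  is_ring_character N (fun i => f (gsimple i) : R[i]).
Proof.
move=> [f1 fM]; split=> [|i j].
  rewrite -f1 /gone functional_gclass (bigD1 ord0) //= big1 => [|i i0].
    by rewrite (mult_tunit hX) eqxx mul1r addr0.
  by rewrite (mult_tunit hX) (negPf i0) mul0r.
by rewrite -[LHS]fM gmul_simple functional_gclass.
Qed.

(** Multiplicativity of the dimensions comes from [hmu]: the functional with values [d] is the first
    entry of [mu], hence an algebra morphism. *)
Lemma dim_simple_ring_character : is_ring_character N d.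
Proof.
have := algebra_morphism_ring_character (tnth_morphism hmu ord0).
have [-> _ _] := hmu; case=> d0 dM.
split=> [|i j]; first by rewrite -[LHS](linextE d).
rewrite -[d i](linextE d) -[d j](linextE d) dM.
by apply: eq_bigr => l _; rewrite linextE.
Qed.

Lemma dim_simple_dual_index i : d (s i) = d i.
Proof. by rewrite /dim_simple (FPdim_dual_index hX sP). Qed.

(** The unit occurs once in [X i \ox X (s i)], so [d i * d (s i)] is 1 plus nonnegative terms and
    [d i] cannot vanish. *)
Lemma dim_simple_gt0 i : 0 < d i.
Proof.
have d_ge0 j : 0 <= d j by rewrite ler0c FPdim_ge0.
have [d0 dM] := dim_simple_ring_character.
rewrite lt_neqAle d_ge0 andbT eq_sym; apply: contraTneq (oner_neq0 R[i]) => di0.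
have := dM i (s i); rewrite di0 mul0r (bigD1 ord0) //=.
rewrite (mult_ord0 hX sP) eqxx d0 mulr1 => e; exfalso.
suff : 0 < 0 :> R[i] by rewrite ltxx.
rewrite [ltRHS]e ltr_pwDl ?ltr01 // sumr_ge0 // => j _.
by rewrite mulr_ge0 ?ler0n.
Qed.

Lemma star_sharp_gsimple f i :
  star X f (sharp X f) (gsimple i) = f (gsimple i) * f (gsimple (s i)) / d i.
Proof.
have d0 := lt0r_neq0 (dim_simple_gt0 i).
rewrite linextE /= !linearZ /= linextE functional_gclass (bigD1 (s i)) //=.
rewrite big1 => [|j ji]; last by rewrite (mult_dual hX sP) (negPf ji) mul0r.
rewrite (mult_dual hX sP) eqxx mul1r addr0.
by rewrite /GRing.scale /=; field.
Qed.

Lemma dual_index0 : s ord0 = ord0.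
Proof.
have := mult_ord0 hX sP ord0 ord0; have [X0 _ _ _] := hX.
rewrite {2}X0 (mult_iso _ (isomorphic_runit _)) (mult_simple hX) eqxx.
by case: eqP.
Qed.

(** Evaluation at the unit object shows that the coefficient in the grouplike condition can only be
    1; the condition is then an equality with the first character, read on each simple class. *)
Lemma dual_grouplikeP j : let u i := tnth mu j (gsimple i) : R[i] in
  is_dual_grouplike X mu (tnth mu j) <-> forall i, u i * u (s i) = d i ^+ 2.
Proof.
move=> u; set f := tnth mu j; have [mu0 _ _] := hmu.
have [u0 _] : is_ring_character N u.
  exact: algebra_morphism_ring_character (tnth_morphism hmu j).
have d0 i := lt0r_neq0 (dim_simple_gt0 i).
split=> [fgl i|u2].
  set c := phat X mu ord0 f (sharp X f) in fgl *.
  have starE l : u l * u (s l) / d l = c * d l.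
    by rewrite -star_sharp_gsimple fgl mu0 lfunE /= linextE.
  have c1 : c = 1.
    have := starE ord0; rewrite dual_index0 u0 dim_simple_ring_character.1.
    by rewrite invr1 !mulr1 => ->.
  by rewrite -[LHS](divfK (d0 i)) starE c1 mul1r expr2.
(* The product is the first character itself, whose coordinate at [ord0] in the free family [mu] is
   1. *)
have star_mu0 : star X f (sharp X f) = tnth mu ord0.
  apply: functional_ext => i; rewrite star_sharp_gsimple mu0 linextE.
  by rewrite [X in X / _](u2 i) expr2 mulfK.
rewrite /is_dual_grouplike /phat star_mu0 (tnth_nth 0).
by rewrite (coord_free _ _ (character_list_free hmu)) eqxx scale1r.
Qed.

Lemma morphism_prod_normalised f : is_algebra_morphism X f ->
  f (\big[gmul X/gone X _]_(i < n.+1) ((d i)^-1 *: gsimple i))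
    = \prod_i (f (gsimple i) / d i).
Proof.
move=> fC; rewrite algebra_morphism_prod //; apply: eq_bigr => i _.
by rewrite linearZ /=; exact: mulrC.
Qed.

Lemma FPdim_adE : (FPdim_ad X)%:C = \sum_(i | ad i) d i ^+ 2.
Proof.
rewrite /FPdim_ad rmorph_sum; apply: eq_bigr => i _.
by rewrite rmorphXn.
Qed.

Lemma dual_Burnside_identity :
  dual_Burnside X mu <->
  gmul X (\big[gmul X/gone X _]_(i < n.+1) ((d i)^-1 *: gsimple i))
         (\big[gmul X/gone X _]_(i < n.+1) ((d i)^-1 *: gsimple i))
    = ((FPdim_ad X)%:C)^-1 *:
        \sum_(i < n.+1 | ad i) d i *: gsimple i.
Proof.
set p := \big[gmul X/gone X _]_i _; set r := _ *: _.
pose u j i : R[i] := tnth mu j (gsimple i).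
have uC j : is_ring_character N (u j).
  exact: algebra_morphism_ring_character (tnth_morphism hmu j).
have s_inv := dual_index_involutive hX sP hcomm.
have [d_gt0 dC] := (dim_simple_gt0, dim_simple_ring_character).
have ad0 : ad ord0.
  by apply/asboolP; have [-> _ _ _] := hX; exact: adjoint_tunit.
have ad_mul i j l : ad i -> ad j -> N i j l != 0%N -> ad l.
  move=> /asboolP ai /asboolP aj Nl; apply/asboolP.
  by apply: (adjoint_constituent hX _ Nl); exact: adjoint_tens.
have ad_s i : ad i -> ad (s i).
  move=> /asboolP ai; apply/asboolP.
  by apply: (adjoint_iso hX (sP i)); exact: adjoint_dual.
have ad_mul_s i l : N i (s i) l != 0%N -> ad l.
  by move=> Nl; apply/asboolP; exact: (adjoint_mul_dual hX sP Nl).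
have ad_min (P : 'I_n.+1 -> Prop) : P ord0 ->
    (forall i j l, P i -> P j -> N i j l != 0%N -> P l) ->
    (forall i, P i -> P (s i)) -> (forall i l, N i (s i) l != 0%N -> P l) ->
    forall i, ad i -> P i.
  move=> P0 Pm Ps Pad i /asboolP; exact: (adjoint_minimal hX sP).
have glP j : is_dual_grouplike X mu (tnth mu j) <-> forall i, ad i -> u j i = d i.
  rewrite dual_grouplikeP.
  exact: (ring_character_ad_trivialP d_gt0 dC dim_simple_dual_index ad_mul_s
           ad_min (uC j)).
have pE j : tnth mu j (gmul X p p) = (\prod_i (u j i / d i)) ^+ 2.
  rewrite (tnth_morphism hmu j).2 morphism_prod_normalised //.
  exact: tnth_morphism.
have rE j : tnth mu j r = (\sum_(i | ad i) d i ^+ 2)^-1 * \sum_(i | ad i) d i * u j i.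
  rewrite linearZ /= FPdim_adE linear_sum; congr (_ * _); apply: eq_bigr => i _.
  by rewrite linearZ.
have p_gl j : is_dual_grouplike X mu (tnth mu j) -> tnth mu j (gmul X p p) = 1.
  move/dual_grouplikeP => u2; rewrite pE.
  exact: (ring_character_prod_sqr d_gt0 s_inv dim_simple_dual_index).
have r_gl j : is_dual_grouplike X mu (tnth mu j) -> tnth mu j r = 1.
  move/glP => u_ad; rewrite rE (ring_character_sum_ad u_ad) mulVf //.
  by rewrite lt0r_neq0 // (sum_ad_gt0 d_gt0).
have r_ngl j : ~ is_dual_grouplike X mu (tnth mu j) -> tnth mu j r = 0.
  rewrite glP rE => u_nad.
  have := ring_character_sum_ad0 dC dim_simple_dual_index (mult_frobenius hX sP)
            ad_mul ad_s (uC j) u_nad.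
  by move=> ->; rewrite mulr0.
have p0 j : tnth mu j (gmul X p p) = 0 <-> exists i, tnth mu j (gsimple i) = 0.
  rewrite pE; split=> [/eqP|[i ui0]]; last first.
    by rewrite (bigD1 i) //= /u ui0 !mul0r expr0n.
  rewrite expf_eq0 /= => /prodf_eq0 [i _].
  rewrite mulf_eq0 invr_eq0 (negPf (lt0r_neq0 (d_gt0 i))) orbF => /eqP ui0.
  by exists i.
split=> [B|pr j].
  apply: (character_list_separates hmu) => j.
  have [gl|ngl] := pselect (is_dual_grouplike X mu (tnth mu j)).
    by rewrite p_gl // r_gl.
  by rewrite r_ngl //; apply/p0/B.
(* A grouplike character is 1 on the left-hand side of the identity, so it does not vanish there;
   any other kills the right-hand side, hence by [pr] also the left. *)
rewrite -p0; split=> [pj0 /p_gl|/r_ngl]; last by rewrite pr.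
by rewrite pj0 => /eqP; rewrite eq_sym oner_eq0.
Qed.

End DualBurnside.

Unset Implicit Arguments.

Theorem theorem1p12 (R : realType) (C : fusion_category R[i]) (n : nat)
    (X : 'I_n.+1 -> C) (hX : simple_representatives X)
    (hcomm : groth_commutative X)
    (mu : n.+1.-tuple 'Hom('rV[R[i]]_n.+1, R[i]^o))
    (hmu : is_character_list X mu) :
  dual_Burnside X mu <->
  gmul X (\big[gmul X/gone X _]_(i < n.+1) ((dim_simple X i)^-1 *: gsimple i))
         (\big[gmul X/gone X _]_(i < n.+1) ((dim_simple X i)^-1 *: gsimple i))
    = ((FPdim_ad X)%:C)^-1 *:
        \sum_(i < n.+1 | `[< adjoint_subcategory X (X i) >]) dim_simple X i *: gsimple i.
Proof.
have [s sP] := exists_dual_index hX.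
exact: (dual_Burnside_identity hX hcomm hmu sP).
Qed.
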